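(* Let $q$ be a power of $2$, let $0<i<m$ be integers with $i\nmid m$, and let $a,b\in\mathbb{F}_q\setminus\{0\}$. Then the polycyclic code $C$ over $\mathbb{F}_q$ of length $2m$ associated with the trinomial $x^{2m}+a^2x^{2i}+b^2$ and generated by $g(x)=x^m+ax^i+b$ is isodual.
   Context: Vectors $(c_0,\dots,c_{n-1})\in\mathbb{F}_q^n$ are identified with polynomials $c_0+c_1x+\cdots+c_{n-1}x^{n-1}$. For a monic polynomial $f(x)\in\mathbb{F}_q[x]$ of degree $n$ and a monic divisor $g(x)$ of $f(x)$, the polycyclic code associated with $f(x)$ and generated by $g(x)$ is the ideal $\langle g(x)\rangle$ of $\mathbb{F}_q[x]/\langle f(x)\rangle$, i.e. the set of all multiples of $g(x)$ of degree less than $n$, viewed as a linear code of length $n$. Two linear codes $C_1,C_2$ of length $n$ over $\mathbb{F}_q$ are equivalent if there is a monomial $n\times n$ matrix $M$ over $\mathbb{F}_q$ (exactly one non-zero entry in each row and each column) with $C_2=\{cM: c\in C_1\}$. The dual $C^\perp$ is taken with respect to the Euclidean inner product; $C$ is isodual if $C$ is equivalent to $C^\perp$. *)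

(* Defs.v *)
From mathcomp Require Import all_boot all_algebra.

Set Implicit Arguments.
Unset Strict Implicit.
Unset Printing Implicit Defensive.

Import GRing.Theory.
Local Open Scope ring_scope.

(* Codes of length n are sets of row vectors; the vector c is identified with
   the polynomial rVpoly c = \sum_i c 0 i *: 'X^i. *)

(* The ideal generated by the class of g in F[x]/(f), for f of degree n: each
   class is represented by its element of degree < n, so that both the
   multiplier h and the codeword c range over vectors of length n. *)
Definition polycyclic_code (F : finFieldType) (n : nat) (f g : {poly F}) :
    {set 'rV[F]_n} :=
  [set c : 'rV[F]_n | [exists h : 'rV[F]_n,
     rVpoly c == (rVpoly h * g) %% f]].

Definition dual_code (F : finFieldType) (n : nat) (C : {set 'rV[F]_n}) :
    {set 'rV[F]_n} :=
  [set y : 'rV[F]_n | [forall c in C, \sum_(j < n) c 0 j * y 0 j == 0]].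

Definition is_monomial_mx (F : finFieldType) (n : nat) (M : 'M[F]_n) : Prop :=
  (forall i : 'I_n, exists! j : 'I_n, M i j != 0) /\
  (forall j : 'I_n, exists! i : 'I_n, M i j != 0).

Definition equivalent_codes (F : finFieldType) (n : nat)
    (C1 C2 : {set 'rV[F]_n}) : Prop :=
  exists2 M : 'M[F]_n, is_monomial_mx M & C2 = [set c *m M | c in C1].

Definition isodual (F : finFieldType) (n : nat) (C : {set 'rV[F]_n}) : Prop :=
  equivalent_codes C (dual_code C).

Lemma polycyclic_code_linear (F : finFieldType) (n : nat) (f g : {poly F}) :
  linear_closed (polycyclic_code n f g).
Proof.
move=> a u v; rewrite !inE => /existsP[h /eqP hu] /existsP[k /eqP kv].
apply/existsP; exists (a *: h + k); apply/eqP.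
by rewrite !linearP /= hu kv mulrDl -scalerAl modpD modpZl.
Qed.

Lemma mem_polycyclic_code (F : finFieldType) (n : nat) (f g : {poly F})
    (c : 'rV[F]_n) :
  f \is monic -> size f = n.+1 -> g %| f ->
  (c \in polycyclic_code n f g) = (g %| rVpoly c).
Proof.
move=> f_monic sz_f gf; have f0 := monic_neq0 f_monic.
have g0 : g != 0 by apply: contraTneq gf => ->; rewrite dvd0p.
have sz_c : (size (rVpoly c) < size f)%N by rewrite sz_f ltnS size_poly.
rewrite inE; apply/existsP/idP => [[h /eqP ->]|g_c].
  by rewrite -(dvdp_mod _ gf) dvdp_mull.
have sz_h : (size (rVpoly c %/ g)%R <= n)%N.
  by rewrite (leq_trans (leq_divp _ _)) // size_poly.
by exists (poly_rV (rVpoly c %/ g)); rewrite poly_rV_K // divpK // modp_small.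
Qed.

(* Main.v *)
Require Import Defs.
From mathcomp Require Import all_boot all_algebra.
From mathcomp Require Import finfield zify ring.

Set Implicit Arguments.
Unset Strict Implicit.
Unset Printing Implicit Defensive.

Import GRing.Theory.
Local Open Scope ring_scope.

(* The codewords are c = u g with deg u < m, i.e. c_p = b u_p + a u_(p-i) +
   u_(p-m), where u vanishes outside [0, m).  For p < i this reads c_p = b u_p,
   and for p >= m + i it reads c_p = u_(p-m), so all the u_k can be read off
   the positions outside [i, m + i).  Dually, y is orthogonal to the code iff
   b y_k + a y_(k+i) + y_(k+m) = 0 for all k < m, so that the values of y on
   [i, m + i) are free and determine the others.  The monomial map makes
   y_(m+i-1-k) = u_k, and sends the remaining positions so that, in
   characteristic 2, these two systems of equations become the same. *)

(* Modulo m this is the reflection p |-> i - 1 - p, and it exchanges [i, m + i)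
   with its complement in [0, 2m). *)
Definition reflect_pos (i m p : nat) : nat :=
  (if (p < i) || (m <= p < m + i) then m + i - 1 - p else 2 * m + i - 1 - p)%N.

(** The factor cancels the b in c_p = b u_p for p < i; on the partner positions [m, m + i) it solves
    the dual relation for y_k with k < i. *)
Definition reflect_scale (F : fieldType) (i m : nat) (b : F) (p : nat) : F :=
  if (p < i)%N || (m <= p < m + i)%N then b^-1 else 1.

Lemma reflect_pos_lt (i m p : nat) :
  (i < m -> p < 2 * m -> reflect_pos i m p < 2 * m)%N.
Proof. by rewrite /reflect_pos; case: ifP; lia. Qed.

Lemma reflect_posK (i m p : nat) :
  (i < m -> p < 2 * m -> reflect_pos i m (reflect_pos i m p) = p)%N.
Proof. by rewrite /reflect_pos; case: ifP; case: ifP; lia. Qed.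

(** The reflection swaps [0, i) with [m, m + i), so their union is stable. *)
Lemma reflect_scaleE (F : fieldType) (i m : nat) (b : F) (p : nat) :
  (i < m)%N -> (p < 2 * m)%N ->
  reflect_scale i m b (reflect_pos i m p) = reflect_scale i m b p.
Proof.
by rewrite /reflect_scale /reflect_pos; case: ifP; case: ifP => //; lia.
Qed.

(** * Trinomials *)

Lemma coef_mul_trinomial (R : comNzRingType) (i m : nat) (a b : R)
    (u : {poly R}) (p : nat) :
  (u * ('X^m + a *: 'X^i + b%:P))`_p =
  (if (p < m)%N then 0 else u`_(p - m)) +
  a * (if (p < i)%N then 0 else u`_(p - i)) + b * u`_p.
Proof.
by rewrite !mulrDr -scalerAr !coefD coefZ !coefMXn coefMC [u`_p * b]mulrC.
Qed.

Lemma size_trinomial (R : comNzRingType) (i m : nat) (a b : R) :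
  (0 < i < m)%N -> size ('X^m + a *: 'X^i + b%:P : {poly R}) = m.+1.
Proof.
move=> /andP[i0 im]; rewrite -addrA size_polyDl size_polyXn //.
rewrite (leq_ltn_trans (size_polyD _ _)) // gtn_max.
rewrite (leq_ltn_trans (size_scale_leq _ _)) ?size_polyXn //.
by rewrite (leq_ltn_trans (size_polyC_leq1 _)) //; lia.
Qed.

Lemma monic_trinomial (R : comNzRingType) (i m : nat) (a b : R) :
  (0 < i < m)%N -> ('X^m + a *: 'X^i + b%:P : {poly R}) \is monic.
Proof.
move=> h; rewrite monicE lead_coefE size_trinomial //= !coefD coefZ !coefXn.
rewrite coefC eqxx; case/andP: h => i0 im.
by rewrite gtn_eqF // gtn_eqF ?mulr0 ?addr0 //; lia.
Qed.

(** * The code and its dual *)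

Section TrinomialCode.

Variables (F : finFieldType) (i m : nat) (a b : F).
Hypotheses (char2 : 2%N \in [pchar F]) (i_gt0 : (0 < i)%N) (lt_im : (i < m)%N).
Hypothesis (b_neq0 : b != 0).

Let g : {poly F} := 'X^m + a *: 'X^i + b%:P.
Let f : {poly F} := 'X^(2 * m) + (a ^+ 2) *: 'X^(2 * i) + (b ^+ 2)%:P.
Let C := polycyclic_code (2 * m) f g.

(** Squaring is the Frobenius map of F[x], hence additive. In particular g divides f. *)
Lemma trinomial_sqr : f = g ^+ 2.
Proof.
have char2P : 2%N \in [pchar {poly F}] by rewrite pchar_poly.
rewrite /f -(pFrobenius_autE char2P) !rmorphD /= !pFrobenius_autE.
by rewrite exprZn -!exprM ![(_ * 2)%N]mulnC polyC_exp.
Qed.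

Lemma mem_trinomial_code (c : 'rV[F]_(2 * m)) :
  reflect (exists2 u : {poly F}, (size u <= m)%N & rVpoly c = u * g)
          (c \in C).
Proof.
have g_monic : g \is monic by apply: monic_trinomial; lia.
have szg : size g = m.+1 by apply: size_trinomial; lia.
rewrite mem_polycyclic_code; first last.
- by rewrite trinomial_sqr expr2 dvdp_mull.
- by apply: size_trinomial; lia.
- by apply: monic_trinomial; lia.
apply: (iffP idP) => [/divpK c_g|[u _ ->]]; last exact: dvdp_mull.
exists (rVpoly c %/ g); rewrite // size_divp ?monic_neq0 // szg /=.
by rewrite leq_subLR addnn -mul2n size_poly.
Qed.

(** The shifts x^k g with k < m span the code, and the relation at k is orthogonality to x^k g. *)
Lemma mem_dual_trinomial_code (y : 'rV[F]_(2 * m)) :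
  reflect (forall k, (k < m)%N ->
             b * (rVpoly y)`_k + a * (rVpoly y)`_(k + i)
             + (rVpoly y)`_(k + m) = 0)
          (y \in dual_code C).
Proof.
have szg : size g = m.+1 by apply: size_trinomial; lia.
have pick (k : nat) (z : F) : (k < 2 * m)%N ->
    \sum_(j < 2 * m) (if j == k :> nat then z else 0) * y 0 j
    = z * (rVpoly y)`_k.
  move=> lt_k; rewrite (bigD1 (Ordinal lt_k)) //= eqxx big1 ?addr0.
    by rewrite -coef_rVpoly_ord.
  by move=> j /negPf; rewrite -val_eqE /= => ->; rewrite mul0r.
have rowE k : (k < m)%N ->
    \sum_(j < 2 * m) ('X^k * g)`_j * y 0 j =
    b * (rVpoly y)`_k + a * (rVpoly y)`_(k + i) + (rVpoly y)`_(k + m).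
  move=> lt_k; rewrite -[X in _ + X]mul1r -!pick; try lia.
  rewrite -!big_split; apply: eq_bigr => j _ /=; rewrite -!mulrDl.
  congr (_ * _); rewrite coefXnM /g !coefD coefZ !coefXn coefC.
  case: ltnP => [lt_jk|le_kj].
    by rewrite !ifF ?addr0 //; apply/eqP; lia.
  rewrite (_ : (j - k == m)%N = (j == k + m :> nat)%N); last by lia.
  rewrite (_ : (j - k == i)%N = (j == k + i :> nat)%N); last by lia.
  rewrite (_ : (j - k == 0)%N = (j == k :> nat)%N); last by lia.
  by do 3!case: eqP => _ /=; ring.
rewrite inE; apply: (iffP forall_inP) => [y_dual k lt_k|y_rec c].
  rewrite -rowE //.
  have sz : (size ('X^k * g)%R <= 2 * m)%N.
    by rewrite (leq_trans (size_polyMleq _ _)) // szg size_polyXn; lia.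
  apply: etrans (eqP (y_dual (poly_rV ('X^k * g)) _)).
    by apply: eq_bigr => j _; rewrite mxE.
  apply/mem_trinomial_code; exists 'X^k; first by rewrite size_polyXn.
  by rewrite poly_rV_K.
move=> /mem_trinomial_code[u sz_u c_ug].
(* Expand c = u g as the combination of the x^k g with coefficients u_k. *)
have -> : \sum_(j < 2 * m) c 0 j * y 0 j =
    \sum_(k < m) u`_k * \sum_(j < 2 * m) ('X^k * g)`_j * y 0 j.
  under [RHS]eq_bigr do rewrite big_distrr /=.
  rewrite exchange_big; apply: eq_bigr => j _ /=.
  rewrite -coef_rVpoly_ord c_ug.
  have {1}-> : u = \poly_(k < m) u`_k.
    apply/polyP => k; rewrite coef_poly; case: ltnP => // le_mk.
    by rewrite nth_default // (leq_trans sz_u).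
  rewrite poly_def mulr_suml coef_sum mulr_suml; apply: eq_bigr => k _.
  by rewrite -scalerAl coefZ mulrA.
by apply/eqP; rewrite big1 // => k _; rewrite rowE // y_rec ?mulr0.
Qed.

(** * The monomial map *)

Definition reflect_ord (p : 'I_(2 * m)) : 'I_(2 * m) :=
  Ordinal (reflect_pos_lt lt_im (ltn_ord p)).

Lemma reflect_ordK : involutive reflect_ord.
Proof. by move=> p; apply: val_inj; rewrite /= reflect_posK. Qed.

Definition reflect_mx : 'M[F]_(2 * m) :=
  \matrix_(p, q) (if q == reflect_ord p then reflect_scale i m b p else 0).

Lemma reflect_scale_neq0 (p : nat) : reflect_scale i m b p != 0.
Proof. by rewrite /reflect_scale; case: ifP; rewrite ?invr_eq0 ?oner_eq0. Qed.

Lemma reflect_mx_monomial : is_monomial_mx reflect_mx.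
Proof.
split=> p; exists (reflect_ord p); split; rewrite ?mxE ?reflect_ordK.
- by rewrite eqxx reflect_scale_neq0.
- by move=> q; rewrite mxE; case: (q =P _) => //; rewrite eqxx.
- by rewrite eqxx reflect_scale_neq0.
- move=> q; rewrite mxE; case: (p =P _) => [-> _|]; last by rewrite eqxx.
  by rewrite reflect_ordK.
Qed.

Lemma reflect_mxE (c : 'rV[F]_(2 * m)) (q : 'I_(2 * m)) :
  (c *m reflect_mx) 0 q = reflect_scale i m b q * c 0 (reflect_ord q).
Proof.
rewrite mxE (bigD1 (reflect_ord q)) //= mxE reflect_ordK eqxx.
rewrite big1 ?addr0 => [|p].
  by rewrite mulrC reflect_scaleE.
rewrite mxE; case: (q =P _) => [->|]; last by rewrite mulr0.
by rewrite reflect_ordK eqxx.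
Qed.

Lemma coef_reflect_mx (c : 'rV[F]_(2 * m)) (q : nat) : (q < 2 * m)%N ->
  (rVpoly (c *m reflect_mx))`_q =
  reflect_scale i m b q * (rVpoly c)`_(reflect_pos i m q).
Proof.
move=> lt_q; have := reflect_mxE c (Ordinal lt_q).
by rewrite -!coef_rVpoly_ord.
Qed.

(** The map carries c on [i, m + i) to y outside it. There the coefficient formula for u g turns
    into the dual relation, signs being irrelevant in characteristic 2. *)
Lemma reflect_mx_dual (c : 'rV[F]_(2 * m)) :
  (c *m reflect_mx \in dual_code C) = (c \in C).
Proof.
set y := c *m reflect_mx.
have opp2 (x : F) : - x = x by rewrite oppr_pchar2.
apply/mem_dual_trinomial_code/mem_trinomial_code => [y_rec|[u sz_u c_ug] k lt_k].
  (* For k < m the index m + i - 1 - k runs through the free positions [i, m + i). *)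
  pose u := \poly_(k < m) (rVpoly y)`_(m + i - 1 - k).
  have uE k : u`_k = if (k < m)%N then (rVpoly y)`_(m + i - 1 - k) else 0.
    by rewrite coef_poly.
  exists u; first exact: size_poly.
  have y_top k : (k < m)%N -> (rVpoly y)`_(k + m) =
      b * (rVpoly y)`_k + a * (rVpoly y)`_(k + i).
    by move=> /y_rec/eqP; rewrite addrC addr_eq0 opp2 => /eqP.
  apply/polyP => p; rewrite coef_mul_trinomial !uE.
  have [le_p|lt_p] := leqP (2 * m) p.
    rewrite nth_default ?(leq_trans (size_poly _ _)) //.
    by do !(rewrite ifF; last by apply/negP; lia); ring.
  have -> : (rVpoly c)`_p =
      (reflect_scale i m b p)^-1 * (rVpoly y)`_(reflect_pos i m p).
    rewrite coef_reflect_mx ?reflect_pos_lt // reflect_posK // reflect_scaleE //.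
    by rewrite mulKf ?reflect_scale_neq0.
  rewrite /reflect_scale /reflect_pos.
  case: (ltnP p i) => /= [lt_pi|le_ip].
    by rewrite !ifT ?invrK; [ring | lia..].
  case: (ltnP p m) => /= [lt_pm|le_mp].
    (* The dual relation at k = m + i - 1 - p gives b u_p + a u_(p-i). *)
    have -> : (2 * m + i - 1 - p = (m + i - 1 - p) + m)%N by lia.
    rewrite y_top ?ifT; try lia.
    have -> : (m + i - 1 - p + i = m + i - 1 - (p - i))%N by lia.
    by rewrite invr1; ring.
  case: (ltnP p (m + i)) => [lt_pmi|le_mip].
    rewrite !ifT; try lia.
    (* The same relation now expands u_(p-m); its term in a cancels a u_(p-i), leaving b y_k =
       c_p. *)
    have -> : (m + i - 1 - (p - m) = (m + i - 1 - p) + m)%N by lia.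
    rewrite y_top; last by lia.
    have -> : (m + i - 1 - p + i = m + i - 1 - (p - i))%N by lia.
    by rewrite invrK mulr0 addr0 addrK_pchar2.
  rewrite ifT ?ifF; try lia.
  have -> : (2 * m + i - 1 - p = m + i - 1 - (p - m))%N by lia.
  by rewrite invr1; ring.
have u0 j : (m <= j)%N -> u`_j = 0.
  by move=> le_mj; rewrite nth_default // (leq_trans sz_u).
have yE q : (q < 2 * m)%N -> (rVpoly y)`_q =
    reflect_scale i m b q * (u * g)`_(reflect_pos i m q).
  by move=> lt_q; rewrite coef_reflect_mx // c_ug.
have yu j : (j < m)%N -> (rVpoly y)`_(m + i - 1 - j) = u`_j.
  move=> lt_j; rewrite yE; last by lia.
  rewrite coef_mul_trinomial /reflect_scale /reflect_pos.
  case: (ltnP j i) => [lt_ji|le_ij].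
    have -> : (m <= m + i - 1 - j < m + i)%N by lia.
    have -> : (m + i - 1 - (m + i - 1 - j) = j)%N by lia.
    by rewrite orbT lt_ji (ltn_trans lt_ji) // mulr0 !add0r mulKf.
  rewrite ifF ?[in RHS]ifF; try lia.
  have -> : (2 * m + i - 1 - (m + i - 1 - j) = j + m)%N by lia.
  rewrite ifF ?ifF; try lia.
  rewrite addnK [u`_(j + m - i)]u0 ?[u`_(j + m)]u0; try lia.
  by rewrite !mulr0 mul1r !addr0.
(* Position k + i is always free, and so is exactly one of k + m (if k < i) and k (if k >= i). The
   remaining coordinate is computed from u g. *)
have -> : (k + i = m + i - 1 - (m - 1 - k))%N by lia.
rewrite yu; last by lia.
case: (ltnP k i) => [lt_ki|le_ik].
  have -> : (k + m = m + i - 1 - (i - 1 - k))%N by lia.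
  rewrite yu; last by lia.
  rewrite yE; last by lia.
  rewrite coef_mul_trinomial /reflect_scale /reflect_pos lt_ki /= mulVKf //.
  rewrite !ifF ?[u`_(m + i - 1 - k)]u0; try lia.
  have -> : (m + i - 1 - k - m = i - 1 - k)%N by lia.
  have -> : (m + i - 1 - k - i = m - 1 - k)%N by lia.
  by rewrite mulr0 addr0 addrK_pchar2 // addrr_pchar2.
have {1}-> : (k = m + i - 1 - (m + i - 1 - k))%N by lia.
rewrite yu ?yE; try lia.
rewrite coef_mul_trinomial /reflect_scale /reflect_pos.
have -> /= : (k + m < i)%N || (m <= k + m < m + i)%N = false by lia.
have -> : (2 * m + i - 1 - (k + m) = m + i - 1 - k)%N by lia.
have -> : (m + i - 1 - k - i = m - 1 - k)%N by lia.
rewrite ifT ?ifF; try lia.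
by rewrite mul1r add0r [X in X + _]addrC addrr_pchar2.
Qed.

Lemma trinomial_code_isodual : isodual C.
Proof.
exists reflect_mx; first exact: reflect_mx_monomial.
apply/setP => y; apply/idP/imsetP => [y_dual|[c cC ->]]; last first.
  by rewrite reflect_mx_dual.
(* The preimage of y: the reflection is its own inverse and preserves the scale. *)
pose c := \row_p ((reflect_scale i m b p)^-1 * y 0 (reflect_ord p)).
have y_c : y = c *m reflect_mx.
  apply/rowP => q; rewrite reflect_mxE mxE reflect_ordK /= reflect_scaleE //.
  by rewrite mulVKf ?reflect_scale_neq0.
by exists c; rewrite // -reflect_mx_dual -y_c.
Qed.

End TrinomialCode.

Theorem theorem4p3 (F : finFieldType) (e : nat) (hF : #|F| = (2 ^ e)%N)
    (i m : nat) (hi : (0 < i)%N) (him : (i < m)%N) (hndvd : ~~ (i %| m)%N)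
    (a b : F) (ha : a != 0) (hb : b != 0) :
  isodual (polycyclic_code (2 * m)
    ('X^(2 * m) + (a ^+ 2) *: 'X^(2 * i) + (b ^+ 2)%:P)
    ('X^m + a *: 'X^i + b%:P)).
Proof. exact: trinomial_code_isodual (card_finPcharP hF isT) hi him hb. Qed.
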